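(* Let $(M,g_0)$ be a closed Riemannian manifold containing a totally geodesic flat $2$-torus $\mathbb{T}^2\subset M$, let $g_1$ be another Riemannian metric on $M$, and for $t\in[0,1]$ let $g_t:=(1-t)g_0+tg_1$, with curvature tensor $R_t$. Let $X,Y$ be vector fields tangent to $\mathbb{T}^2$ with $\nabla^0_XX=\nabla^0_XY=\nabla^0_YY=0$ on $\mathbb{T}^2$. Then for all sufficiently small $t$ (such that $\|t(I-P)\|<1$), along $\mathbb{T}^2$, $$\begin{aligned}R_t(X,Y,Y,X)=\;&(1-t)R_0(X,Y,Y,X)+tR_1(X,Y,Y,X)\\&+t\Bigl[g_1\bigl((\nabla^1_XX)^\perp,(\nabla^1_YY)^\perp\bigr)-g_1\bigl((\nabla^1_XY)^\perp,(\nabla^1_XY)^\perp\bigr)\Bigr]\\&+t\Bigl[g_1\bigl((\nabla^1_XX)^\top,(\nabla^1_YY)^\top\bigr)-g_1\bigl((\nabla^1_XY)^\top,(\nabla^1_XY)^\top\bigr)\Bigr]\\&-t^2\sum_{n=1}^\infty\Bigl[g_1\bigl(P(t(I-P))^{n-1}\nabla^1_XX,\nabla^1_YY\bigr)-g_1\bigl(P(t(I-P))^{n-1}\nabla^1_XY,\nabla^1_XY\bigr)\Bigr].\end{aligned}$$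
   Context: $\nabla^0,\nabla^1$ are the Levi-Civita connections of $g_0,g_1$ on $M$. $P$ is the field of endomorphisms of $TM$ defined by $g_0(PU,V)=g_1(U,V)$ for all $U,V$; $I$ is the identity, $(t(I-P))^0=I$, and $\|\cdot\|$ is the operator norm. The superscripts $^\top$ and $^\perp$ denote the $g_1$-orthogonal projections onto $T\mathbb{T}^2$ and onto its $g_1$-orthogonal complement. Curvature sign convention: $R_t(X,Y,Y,X)$ equals the $g_t$-sectional curvature of $\mathrm{span}(X,Y)$ times $g_t(X,X)g_t(Y,Y)-g_t(X,Y)^2$ (for $X,Y$ linearly independent); in particular $R_0$ and $R_1$ are the curvature tensors of $g_0$ and $g_1$. *)

(* Defs.v *)
(* MathComp-Analysis *)
From mathcomp Require Import all_boot all_order all_algebra.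
From mathcomp Require Import all_classical all_reals all_analysis.

Set Implicit Arguments.
Unset Strict Implicit.
Unset Printing Implicit Defensive.

Import Order.TTheory GRing.Theory Num.Theory.
Import numFieldNormedType.Exports.

Local Open Scope classical_set_scope.
Local Open Scope ring_scope.

Fixpoint Ck {R : realType} {n : nat} {W : normedModType R} (k : nat)
    (U : set 'rV[R]_n) (f : 'rV[R]_n -> W) : Prop :=
  match k with
  | 0 => forall x, U x -> {for x, continuous f}
  | k'.+1 => (forall x, U x -> differentiable f x) /\
             (forall v, Ck k' U (fun x => 'D_v f x))
  end.

Definition smooth_on {R : realType} {n : nat} {W : normedModType R}
    (U : set 'rV[R]_n) (f : 'rV[R]_n -> W) : Prop :=
  forall k, Ck k U f.

(* Smooth manifold without boundary: [cmap c] maps the open set [cdom c]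
   homeomorphically onto an open subset of R^n with inverse [cinv c]; the
   values of [cmap c] and [cinv c] outside these open sets are irrelevant. *)
Record manifold (R : realType) (n : nat) := Manifold {
  mcarrier :> topologicalType;
  chart : Type;
  cdom : chart -> set mcarrier;
  cmap : chart -> mcarrier -> 'rV[R]_n;
  cinv : chart -> 'rV[R]_n -> mcarrier;
  mfd_hausdorff : hausdorff_space mcarrier;
  mfd_second_countable : @second_countable mcarrier;
  mfd_cover : forall p, exists c, cdom c p;
  cdom_open : forall c, open (cdom c);
  cimg_open : forall c, open (cmap c @` cdom c);
  cmapK : forall c p, cdom c p -> cinv c (cmap c p) = p;
  cmap_continuous : forall c p, cdom c p -> {for p, continuous (cmap c)};
  cinv_continuous : forall c p, cdom c p ->
    {for cmap c p, continuous (cinv c)};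
  transition_smooth : forall c d,
    smooth_on (cmap c @` (cdom c `&` cdom d)) (cmap d \o cinv c)
}.

Arguments chart {R n} m.
Arguments cdom {R n m} c _.
Arguments cmap {R n m} c _.
Arguments cinv {R n m} c _.

Section Geometry.
Variables (R : realType) (n : nat) (M : manifold R n).

(* A tangent vector is given by its components in all charts; the component in
   a chart not containing the base point is 0 by convention, so that equality
   of tangent vectors is equality of functions. *)
Definition tvec := chart M -> 'rV[R]_n.

Definition tangent (p : M) (u : tvec) : Prop :=
  (forall c, ~ cdom c p -> u c = 0) /\
  (forall c d, cdom c p -> cdom d p ->
     u d = 'D_(u c) (cmap d \o cinv c) (cmap c p)).

Definition smooth_fun (f : M -> R) : Prop :=
  forall c, smooth_on (cmap c @` cdom c) (f \o cinv c).

(* The vector at [p] whose components in the chart [c] are [a]. *)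
Definition of_coord (c : chart M) (p : M) (a : 'rV[R]_n) : tvec :=
  fun d => if p \in cdom d then 'D_a (cmap d \o cinv c) (cmap c p) else 0.

Definition vfield := M -> tvec.

Definition vector_field (X : vfield) : Prop :=
  (forall p, tangent p (X p)) /\
  (forall c, smooth_on (cmap c @` cdom c) (fun x => X (cinv c x) c)).

(* (X f)(p), computed in a chart [c] around [p]; it does not depend on [c]. *)
Definition dirder (c : chart M) (X : vfield) (f : M -> R) (p : M) : R :=
  'D_(X p c) (f \o cinv c) (cmap c p).

Definition bracket (X Y : vfield) : vfield := fun p c =>
  if p \in cdom c then
    'D_(X p c) (fun x => Y (cinv c x) c) (cmap c p)
    - 'D_(Y p c) (fun x => X (cinv c x) c) (cmap c p)
  else 0.

(* Only the values on tangent vectors at the base point matter. *)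
Definition tensor2 := M -> tvec -> tvec -> R.

Definition riemannian_metric (g : tensor2) : Prop :=
  [/\ forall p u v w a, tangent p u -> tangent p v -> tangent p w ->
        g p (a *: u + v) w = a * g p u w + g p v w,
      forall p u v, tangent p u -> tangent p v -> g p u v = g p v u,
      forall p u, tangent p u -> u <> 0 -> 0 < g p u u
    & forall (c : chart M) (i j : 'I_n), smooth_on (cmap c @` cdom c)
        (fun x => g (cinv c x)
           (of_coord c (cinv c x) (delta_mx 0 i))
           (of_coord c (cinv c x) (delta_mx 0 j)))].

Definition connection (nabla : vfield -> vfield -> vfield) : Prop :=
  [/\ forall X Y, vector_field X -> vector_field Y -> vector_field (nabla X Y),
      forall f X X' Y p, smooth_fun f ->
        vector_field X -> vector_field X' -> vector_field Y ->
        nabla (fun q => f q *: X q + X' q) Y p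
        = f p *: nabla X Y p + nabla X' Y p,
      forall X Y Y' p,
        vector_field X -> vector_field Y -> vector_field Y' ->
        nabla X (fun q => Y q + Y' q) p = nabla X Y p + nabla X Y' p
    & forall f X Y p (c : chart M), smooth_fun f ->
        vector_field X -> vector_field Y -> cdom c p ->
        nabla X (fun q => f q *: Y q) p
        = dirder c X f p *: Y p + f p *: nabla X Y p].

Definition levi_civita (g : tensor2) (nabla : vfield -> vfield -> vfield) : Prop :=
  [/\ connection nabla,
      forall X Y p, vector_field X -> vector_field Y ->
        nabla X Y p - nabla Y X p = bracket X Y p
    & forall X Y Z p (c : chart M),
        vector_field X -> vector_field Y -> vector_field Z -> cdom c p ->
        dirder c X (fun q => g q (Y q) (Z q)) p
        = g p (nabla X Y p) (Z p) + g p (Y p) (nabla X Z p)].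

(* Sign convention: [curvature g nabla X Y Y X] is the sectional curvature
   times g(X,X) g(Y,Y) - g(X,Y)^2. *)
Definition curvature (g : tensor2) (nabla : vfield -> vfield -> vfield)
    (X Y Z W : vfield) (p : M) : R :=
  g p (nabla X (nabla Y Z) p - nabla Y (nabla X Z) p
       - nabla (bracket X Y) Z p) (W p).

Definition metric_path (g0 g1 : tensor2) (t : R) : tensor2 :=
  fun p u v => (1 - t) * g0 p u v + t * g1 p u v.

Definition endo_field (P : M -> tvec -> tvec) : Prop :=
  [/\ forall p u, tangent p u -> tangent p (P p u),
      forall p a u v, tangent p u -> tangent p v ->
        P p (a *: u + v) = a *: P p u + P p v
    & forall X, vector_field X -> vector_field (fun p => P p (X p))].

(* t(I - P) *)
Definition tIP (P : M -> tvec -> tvec) (t : R) (p : M) (u : tvec) : tvec :=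
  t *: (u - P p u).

Definition gnorm (g : tensor2) (p : M) (u : tvec) : R := Num.sqrt (g p u u).

Definition opnorm (g : tensor2) (p : M) (A : tvec -> tvec) : \bar R :=
  ereal_sup [set (gnorm g p (A u))%:E
            | u in [set u | tangent p u /\ gnorm g p u <= 1]].

Definition orth_compl (g : tensor2) (p : M) (V : set tvec) : set tvec :=
  [set u | tangent p u /\ forall v, V v -> g p u v = 0].

Definition orth_proj (g : tensor2) (p : M) (V : set tvec) (pr : tvec -> tvec)
    : Prop :=
  forall u, tangent p u ->
    V (pr u) /\ forall v, V v -> g p (u - pr u) v = 0.

Definition pushforward (F : 'rV[R]_2 -> M) (x a : 'rV[R]_2) : tvec :=
  fun d => if F x \in cdom d then 'D_a (cmap d \o F) x else 0.

(* [F] induces an injective smooth immersion of the compact torus R^2/Z^2, i.e.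
   an embedding; the embedded torus is [range F]. *)
Definition torus_embedding (F : 'rV[R]_2 -> M) : Prop :=
  [/\ continuous F,
      forall c : chart M, smooth_on (F @^-1` cdom c) (cmap c \o F),
      forall x y, F x = F y <->
        exists m : 'rV[int]_2, x - y = map_mx intr m
    & forall x a, pushforward F x a = 0 -> a = 0].

Definition torus_tangent (F : 'rV[R]_2 -> M) (p : M) : set tvec :=
  [set u | exists x a, F x = p /\ u = pushforward F x a].

Definition tangent_to_torus (F : 'rV[R]_2 -> M) (X : vfield) : Prop :=
  forall p, range F p -> torus_tangent F p (X p).

(* The second fundamental form of the torus vanishes. *)
Definition totally_geodesic (F : 'rV[R]_2 -> M)
    (nabla : vfield -> vfield -> vfield) : Prop :=
  forall X Y, vector_field X -> vector_field Y ->
    tangent_to_torus F X -> tangent_to_torus F Y ->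
    tangent_to_torus F (nabla X Y).

(* The torus with the metric induced by [g] is locally isometric to the
   Euclidean plane. *)
Definition flat_torus (F : 'rV[R]_2 -> M) (g : tensor2) : Prop :=
  forall x0, exists (U : set 'rV[R]_2) (psi : 'rV[R]_2 -> 'rV[R]_2),
    [/\ open U, U x0, smooth_on U psi
      & forall x a b, U x ->
          g (F x) (pushforward F x a) (pushforward F x b)
          = \sum_(i < 2) 'D_a psi x 0 i * 'D_b psi x 0 i].

End Geometry.

(* Main.v *)
Require Import Defs.
From HB Require Import structures.
From mathcomp Require Import all_boot all_order all_algebra.
From mathcomp Require Import all_classical all_reals all_analysis.
From mathcomp Require Import ring lra.

Set Implicit Arguments.
Unset Strict Implicit.
Unset Printing Implicit Defensive.

Import Order.TTheory GRing.Theory Num.Theory.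
Import numFieldNormedType.Exports.

Local Open Scope classical_set_scope.
Local Open Scope ring_scope.

(** Write [g_t] for the metric on the segment, [nabla_t] for its Levi-Civita
    connection and [A := t (I - P)], so that [g_t u v = g0 (u - A u) v].

    Koszul's formula expresses [2 g (nabla X Y) Z] by derivatives of the metric
    and brackets, linearly in [g]. Therefore the pairings
    [g_t (nabla_t X Y) Z] are affine in [t] ([metric_path_nabla]), although the
    connections are not. By metric compatibility, the curvature
    [R_t (X, Y, Y, X)] consists of terms that are linear in such pairings and of
    the quadratic term [- q_t], where
    [q_t := g_t (nabla_t X X) (nabla_t Y Y) - g_t (nabla_t X Y) (nabla_t X Y)].
    Consequently ([metric_path_curvature])
    [R_t = (1 - t) R_0 + t R_1 + (1 - t) q_0 + t q_1 - q_t].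

    On the torus the three [g0]-covariant derivatives vanish. Hence [q_0 = 0].
    Moreover [g_t (nabla_t X Y) Z = t g1 (nabla_1 X Y) Z], that is
    [(I - A) nabla_t X Y = t P nabla_1 X Y]. Since [A] is a contraction
    for [g0], inverting [I - A] by its Neumann series turns [q_t] into [t^2]
    times the series of the theorem ([neumann_series]). Splitting the arguments
    of [g1] in [q_1] into their tangential and normal parts gives the two
    bracketed terms ([orthogonal_splitting]). All these identities are tested
    against values of vector fields defined on all of [M], so that no extension
    of tangent vectors to vector fields is ever required.

    That [A] is a contraction for small [t], uniformly on [M], follows from an
    inequality [g1 <= C g0], which compactness provides ([metric_dominated]). *)

(** * Smooth maps between normed spaces *)

Section SmoothMaps.
Context {R : realType}.

(** Differentiability is a local property: the difference of two functions
    that agree near [x] is the zero function near [x], hence is differentiable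
    at [x] with differential zero. *)
Lemma near_eq_differentiable (V W : normedModType R) (f g : V -> W) (x : V) :
  (\forall y \near x, f y = g y) -> differentiable f x -> differentiable g x.
Proof.
move=> fg df; have gE : g = f + (g - f) by rewrite addrC subrK.
rewrite gE; apply: differentiableD => //; set h := g - f.
have h0 : \forall y \near x, h y = 0.
  by near=> y; rewrite /h /= !fctE (near fg y) ?subrr.
have hx : h x = 0 by exact: nbhs_singleton h0.
have dh : h \o shift x = cst (h x) + (\0 : V -> W) +o_ 0 id.
  apply: eqaddoE; rewrite hx.
  rewrite (_ : cst 0 + _ = 0); last by apply/funext => y /=; rewrite !fctE addr0.
  rewrite add0r; apply/eqoP => e e0.
  have : \forall y \near 0, h (y + x) = 0.
    have := h0; rewrite (near_shift 0 x) subr0.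
    by apply: filterS => y.
  by apply: filterS => y /= ->; rewrite normr0 mulr_ge0 // ltW.
have c0 : continuous (\0 : V -> W) by move=> ?; exact: cvg_cst.
apply/diff_locallyP; rewrite (diff_unique c0 dh); split=> //.
Unshelve. all: by end_near. Qed.

Lemma derive_comp (U V W : normedModType R) (f : U -> V) (g : V -> W)
    (x v : U) : differentiable f x -> differentiable g (f x) ->
  'D_v (g \o f) x = 'D_('D_v f x) g (f x).
Proof.
move=> df dg; rewrite (deriveE v df) (deriveE _ dg).
by rewrite (deriveE _ (differentiable_comp df dg)) diff_comp.
Qed.

Context {n : nat} {W : normedModType R}.
Implicit Types (f g : 'rV[R]_n -> W) (U : set 'rV[R]_n).

(** The derivatives of two functions that agree on an open set agree there too,
    which is what makes the induction on the order of differentiability go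
    through. *)
Lemma eq_Ck k U f g : open U -> {in U, f =1 g} -> Ck k U f -> Ck k U g.
Proof.
move=> oU; elim: k f g => [|k IH] f g fg.
  move=> cf x Ux; have nfg : \forall y \near x, f y = g y.
    by apply: filterS (open_nbhs_nbhs (conj oU Ux)) => y Uy; apply: fg; rewrite inE.
  rewrite /prop_for /continuous_at -(fg x) ?inE //.
  exact: cvg_trans (near_eq_cvg nfg) (cf x Ux).
have nfg x : U x -> \forall y \near x, f y = g y.
  move=> Ux; apply: filterS (open_nbhs_nbhs (conj oU Ux)) => y Uy.
  by apply: fg; rewrite inE.
move=> [df Df]; split=> [x Ux|v].
  exact: near_eq_differentiable (nfg _ Ux) (df _ Ux).
apply: IH (Df v) => x; rewrite inE => Ux.
exact/near_eq_derive/nfg.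
Qed.

Lemma Ck_linear k U (a : R) f g : open U -> Ck k U f -> Ck k U g ->
  Ck k U (fun x => a *: f x + g x).
Proof.
move=> oU; elim: k f g => [|k IH] f g.
  move=> cf cg x Ux; rewrite /prop_for /continuous_at.
  exact: (cvgD (cvgZl_tmp (k := a) (cf x Ux)) (cg x Ux)).
move=> [df Df] [dg Dg]; split=> [x Ux|v].
  by apply: differentiableD; [apply: differentiableZ; exact: df|exact: dg].
apply: eq_Ck (IH _ _ (Df v) (Dg v)) => // x; rewrite inE => Ux.
have /diff_derivable-/(_ v) dfx := df _ Ux.
have /diff_derivable-/(_ v) dgx := dg _ Ux.
rewrite -(deriveZ _ dfx) -deriveD //; exact: derivableZ.
Qed.

Lemma smooth_on_linear U (a : R) f g : open U -> smooth_on U f -> smooth_on U g ->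
  smooth_on U (fun x => a *: f x + g x).
Proof. by move=> oU sf sg k; exact: Ck_linear. Qed.

Lemma smooth_on_differentiable U f x : smooth_on U f -> U x -> differentiable f x.
Proof. by move=> /(_ 1%N)[+ _]; exact. Qed.

End SmoothMaps.

(** * Inner products on a subspace *)

Section InnerProducts.
Context {R : realType} {V : lmodType R}.

Definition subspace (T : set V) : Prop :=
  T 0 /\ forall (k : R) u v, T u -> T v -> T (k *: u + v).

(** The tangent space at a point is a subset of a much larger space of families of
    components, and a metric is meaningful only on that subset; hence the
    restriction of all the axioms to [T]. *)
Definition inner_product (T : set V) (G : V -> V -> R) : Prop :=
  [/\ subspace T,
      forall (k : R) u v w, T u -> T v -> T w ->
        G (k *: u + v) w = k * G u w + G v w,
      forall u v, T u -> T v -> G u v = G v u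
    & forall u, T u -> u <> 0 -> 0 < G u u].

Section SubspaceTheory.
Variables (T : set V) (T_sub : subspace T).

Lemma subspace0 : T 0. Proof. by case: T_sub. Qed.

Lemma subspaceD u v : T u -> T v -> T (u + v).
Proof. by case: T_sub => _ Tl Tu Tv; rewrite -[u]scale1r; exact: Tl. Qed.

Lemma subspaceZ k u : T u -> T (k *: u).
Proof. by case: T_sub => T0 Tl Tu; rewrite -[_ *: _]addr0; exact: Tl. Qed.

Lemma subspaceB u v : T u -> T v -> T (u - v).
Proof. by case: T_sub => _ Tl Tu Tv; rewrite addrC -scaleN1r; exact: Tl. Qed.

End SubspaceTheory.

Section InnerProductTheory.
Variables (T : set V) (G : V -> V -> R) (G_ip : inner_product T G).

Let T_sub : subspace T. Proof. by case: G_ip. Qed.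
Let T0 : T 0. Proof. exact: subspace0 T_sub. Qed.
Let TD := subspaceD T_sub.
Let TZ := subspaceZ T_sub.
Let TB := subspaceB T_sub.
#[local] Hint Resolve T0 TD TZ TB : core.
Implicit Types (k : R) (u v w : V).

Lemma ipC u v : T u -> T v -> G u v = G v u.
Proof. by case: G_ip => _ _ GC _; exact: GC. Qed.

Lemma ipPl k u v w : T u -> T v -> T w ->
  G (k *: u + v) w = k * G u w + G v w.
Proof. by case: G_ip => _ Gl _ _; exact: Gl. Qed.

Lemma ipDl u v w : T u -> T v -> T w -> G (u + v) w = G u w + G v w.
Proof. by move=> *; rewrite -{1}[u]scale1r ipPl // mul1r. Qed.

Lemma ip0l w : T w -> G 0 w = 0.
Proof.
move=> Tw; have := ipDl T0 T0 Tw.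
by rewrite addr0 => /eqP; rewrite -subr_eq subrr eq_sym => /eqP.
Qed.

Lemma ipZl k u w : T u -> T w -> G (k *: u) w = k * G u w.
Proof. by move=> *; rewrite -[k *: u]addr0 ipPl ?ip0l ?addr0; auto. Qed.

Lemma ipBl u v w : T u -> T v -> T w -> G (u - v) w = G u w - G v w.
Proof. by move=> *; rewrite addrC -scaleN1r ipPl // mulN1r addrC. Qed.

Lemma ip0r w : T w -> G w 0 = 0.
Proof. by move=> Tw; rewrite ipC ?ip0l; auto. Qed.

Lemma ipDr u v w : T u -> T v -> T w -> G w (u + v) = G w u + G w v.
Proof.
by move=> Tu Tv Tw; rewrite ipC ?ipDl; auto; rewrite (ipC Tu) ?(ipC Tv).
Qed.

Lemma ipZr k u w : T u -> T w -> G w (k *: u) = k * G w u.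
Proof. by move=> Tu Tw; rewrite ipC ?ipZl; auto; rewrite (ipC Tu). Qed.

Lemma ipZZ k u : T u -> G (k *: u) (k *: u) = k ^+ 2 * G u u.
Proof. by move=> Tu; rewrite ipZl ?ipZr; auto; rewrite mulrA. Qed.

Lemma ipBr u v w : T u -> T v -> T w -> G w (u - v) = G w u - G w v.
Proof.
by move=> Tu Tv Tw; rewrite ipC ?ipBl; auto; rewrite (ipC Tu) ?(ipC Tv).
Qed.

Lemma ip_ge0 u : T u -> 0 <= G u u.
Proof.
move=> Tu; have [->|/eqP u0] := eqVneq u 0; first by rewrite ip0l; auto.
by case: G_ip => _ _ _ G0; rewrite ltW // G0.
Qed.

(** Expand the nonnegative square of [G v v *: u - G u v *: v]. *)
Lemma ip_cauchy_schwarz u v : T u -> T v -> G u v ^+ 2 <= G u u * G v v.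
Proof.
move=> Tu Tv; have [->|/eqP v0] := eqVneq v 0.
  by rewrite !ip0r ?expr0n ?mulr0; auto.
have Gv : 0 < G v v by case: G_ip => _ _ _ G0; exact: G0.
have : 0 <= G (G v v *: u - G u v *: v) (G v v *: u - G u v *: v).
  by apply: ip_ge0; auto.
rewrite ipBl ?ipBr ?ipZl ?ipZr; auto 6.
rewrite [G v u]ipC // => H; rewrite -(ler_pM2l Gv) -subr_ge0.
by apply: le_trans H _; rewrite le_eqVlt; apply/orP; left; apply/eqP; ring.
Qed.

End InnerProductTheory.
End InnerProducts.

Section OrthogonalSplitting.
Context {R : realType} {V : lmodType R}.
Variables (T : set V) (G : V -> V -> R) (G_ip : inner_product T G).

(** The vector [w - top w] lies in the orthogonal complement of [S], so it
    coincides with the projection [perp w] of [w] onto this complement: their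
    difference lies in the complement and is orthogonal to itself. *)
Lemma orthogonal_splitting (S : set V) (top perp : V -> V) (u v : V) :
  S `<=` T ->
  (forall w, T w -> S (top w) /\ forall s, S s -> G (w - top w) s = 0) ->
  (forall w, T w -> [set s | T s /\ forall r, S r -> G s r = 0] (perp w) /\
     forall s, [set s | T s /\ forall r, S r -> G s r = 0] s ->
       G (w - perp w) s = 0) ->
  T u -> T v ->
  G u v = G (perp u) (perp v) + G (top u) (top v).
Proof.
move=> ST topP perpP; have T_sub : subspace T by case: G_ip.
have TB := subspaceB T_sub; have TD := subspaceD T_sub.
have topT w : T w -> T (top w) by move=> /topP[/ST].
have perpT w : T w -> T (perp w) by move=> /perpP[[]].
have perpE w : T w -> w = perp w + top w.
  move=> Tw; set z := perp w - (w - top w).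
  have [St tP] := topP _ Tw; have [[Tp pS] pP] := perpP _ Tw.
  have Tt := topT _ Tw; have Twt : T (w - top w) by exact: TB.
  have Tz : T z by exact: TB.
  have zS s : S s -> G z s = 0.
    by move=> Ss; rewrite (ipBl G_ip) ?pS ?tP ?subr0 //; exact: ST.
  have /pP : [set s | T s /\ forall r, S r -> G s r = 0] z by split.
  have -> : w - perp w = top w - z.
    by rewrite /z opprB addrA [top w + _]addrC subrK.
  rewrite (ipBl G_ip) // [G (top w) z](ipC G_ip) // zS // sub0r => /eqP.
  rewrite oppr_eq0 => /eqP z0; have [zE|/eqP nz] := eqVneq z 0.
    by rewrite (subr0_eq zE) subrK.
  by case: G_ip => _ _ _ /(_ z Tz nz); rewrite z0 ltxx.
move=> Tu Tv; have [[Tpu pSu] _] := perpP _ Tu; have [[Tpv pSv] _] := perpP _ Tv.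
have [Su _] := topP _ Tu; have [Sv _] := topP _ Tv.
have Ttu := topT _ Tu; have Ttv := topT _ Tv.
rewrite {1}(perpE u Tu) {1}(perpE v Tv).
rewrite (ipDl G_ip) ?(ipDr G_ip) //; try exact: TD.
by rewrite (pSu _ Sv) [G (top u) (perp v)](ipC G_ip) // (pSv _ Su) addr0 add0r.
Qed.

End OrthogonalSplitting.

(** * Pairings with a Neumann series *)

Section NeumannSeries.
Context {R : realType} {V : lmodType R}.
Variables (T : set V) (G0 G1 : V -> V -> R).
Variables (G0_ip : inner_product T G0) (G1_ip : inner_product T G1).
Variables (P : V -> V) (PT : forall u, T u -> T (P u)).
Hypothesis P_def : forall u v, T u -> T v -> G0 (P u) v = G1 u v.
Variables (t q : R) (q0 : 0 <= q) (q1 : q < 1).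
Let A u := t *: (u - P u).
Hypothesis A_contr : forall u, T u -> G0 (A u) (A u) <= q * G0 u u.

Let T_sub : subspace T. Proof. by case: G0_ip. Qed.

Let iterT k a : T a -> T (iter k A a).
Proof.
move=> Ta; elim: k => // k IH; apply: (subspaceZ T_sub).
by apply: (subspaceB T_sub); last exact: PT.
Qed.

(** As [G1 z v = G0 z (P v)], Cauchy-Schwarz for [G0] transfers the geometric
    decay of the [G0]-norm of the iterates to their [G1]-pairings. *)
Lemma contraction_iter_pairing_le a v k : T a -> T v ->
  `|G1 (iter k A a) v|
    <= geometric (Num.sqrt (G0 a a * G0 (P v) (P v))) (Num.sqrt q) k.
Proof.
move=> Ta Tv; have Tk := iterT k Ta; have TPv := PT Tv.
have itq : G0 (iter k A a) (iter k A a) <= q ^+ k * G0 a a.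
  elim: k {Tk} => [|k IH]; first by rewrite mul1r.
  apply: le_trans (A_contr (iterT k Ta)) _.
  by rewrite exprS -mulrA ler_wpM2l.
have sqrtX : Num.sqrt q ^+ k = Num.sqrt (q ^+ k).
  elim: k {Tk itq} => [|k IH]; first by rewrite !expr0 sqrtr1.
  by rewrite !exprS IH sqrtrM.
rewrite /geometric /= -sqrtr_sqr sqrtX -sqrtrM; last first.
  by rewrite mulr_ge0 // (ip_ge0 G0_ip).
apply: ler_wsqrtr.
have -> : G1 (iter k A a) v = G0 (iter k A a) (P v).
  by rewrite (ipC G1_ip) // -P_def // (ipC G0_ip).
apply: le_trans (ip_cauchy_schwarz G0_ip Tk TPv) _.
rewrite mulrAC; apply: ler_wpM2r; first exact: (ip_ge0 G0_ip).
by rewrite mulrC itq.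
Qed.

Let sqrtq_lt1 : `|Num.sqrt q| < 1.
Proof. by rewrite ger0_norm ?sqrtr_ge0 // -[ltRHS]sqrtr1 ltr_sqrt. Qed.

Lemma contraction_iter_pairing_cvg0 a v : T a -> T v ->
  G1 (iter k A a) v @[k --> \oo] --> 0.
Proof.
move=> Ta Tv; apply: norm_cvg0.
apply: (squeeze_cvgr _ (cvg_cst (0 : R)) (cvg_geometric _ sqrtq_lt1)).
by near=> k; rewrite normr_ge0 /=; exact: contraction_iter_pairing_le.
Unshelve. all: by end_near. Qed.

Lemma contraction_iter_pairing_summable a v : T a -> T v ->
  cvgn (series (fun k => G1 (iter k A a) v)).
Proof.
move=> Ta Tv; apply: normed_cvg.
apply: (series_le_cvg _ _ (fun k => contraction_iter_pairing_le k Ta Tv)).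
- by move=> k /=.
- by move=> k; apply: le_trans (contraction_iter_pairing_le k Ta Tv).
- exact: is_cvg_geometric_series.
Qed.

(** With [Gt := (1 - t) G0 + t G1], one has [Gt z w = G0 (z - A z) w], so
    the assumption on [v] is the equation [v - A v = t P c] tested against
    the vectors [P (A^k a)]. The conclusion is the Neumann expansion of [G1 a v]
    for its solution [v = t (I - A)^-1 P c]. As [P] commutes with [A], the
    equation turns the [k]-th term of the series, multiplied by [t], into
    [G1 (A^k a) v - G1 (A^k.+1 a) v], so the partial sums telescope and the
    remainder [G1 (A^N a) v] tends to zero.
    Existence of the limit [l] does not come from this identity, which is void
    when [t = 0], but from the summability of the pairings. *)
Lemma neumann_series a c v : T a -> T c -> T v ->
  (forall k, (1 - t) * G0 v (P (iter k A a)) + t * G1 v (P (iter k A a))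
             = t * G1 c (P (iter k A a))) ->
  exists2 l, (\sum_(1 <= k < N) G1 (P (iter k.-1 A a)) c) @[N --> \oo] --> l
           & t * l = G1 a v.
Proof.
move=> Ta Tc Tv vE; pose u k := G1 (P (iter k A a)) c.
have uE k : u k = G1 (iter k A a) (P c).
  have Tk := iterT k Ta; have TPk := PT Tk; have TPc := PT Tc.
  by rewrite /u (ipC G1_ip) // -P_def // (ipC G0_ip) // P_def.
have su : series u @ \oo --> limn (series u).
  have -> : u = fun k => G1 (iter k A a) (P c) by apply/funext.
  exact: (contraction_iter_pairing_summable Ta (PT Tc)).
exists (limn (series u)).
  rewrite -cvg_shiftS; apply: cvg_trans su; apply: near_eq_cvg.
  by near=> N; rewrite /series /= big_add1.
have stepE k : t * u k = G1 (iter k A a) v - G1 (iter k.+1 A a) v.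
  have Tk := iterT k Ta; have TPk := PT Tk.
  rewrite /u [G1 _ c](ipC G1_ip) // -vE [G0 v _](ipC G0_ip) // P_def //=.
  rewrite (ipZl G1_ip) //; last exact: (subspaceB T_sub).
  by rewrite (ipBl G1_ip) // [G1 v _](ipC G1_ip) //; ring.
have telescope N : t * series u N = G1 a v - G1 (iter N A a) v.
  rewrite /series /= mulr_sumr.
  rewrite (@telescope_sumr_eq _ _ _ (fun k => - G1 (iter k A a) v)) //.
    by rewrite /= opprK addrC.
  by move=> k _; rewrite stepE opprK addrC.
have c1 : t * series u N @[N --> \oo] --> t * limn (series u).
  exact: cvgM (cvg_cst t) su.
have c2 : t * series u N @[N --> \oo] --> G1 a v.
  rewrite (funext telescope).
  have := cvgB (cvg_cst (G1 a v)) (contraction_iter_pairing_cvg0 Ta Tv).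
  by rewrite subr0; exact.
exact: cvg_unique c1 c2.
Unshelve. all: by end_near. Qed.

End NeumannSeries.

(** * Tangent vectors in charts *)

Section TangentVectors.
Context {R : realType} {n : nat} {M : manifold R n}.
Implicit Types (p : M) (c d : chart M) (u v w : tvec M) (a b : 'rV[R]_n).

Lemma transition_differentiable p c d : cdom c p -> cdom d p ->
  differentiable (cmap d \o cinv c) (cmap c p).
Proof.
move=> cp dp; apply: smooth_on_differentiable (@transition_smooth _ _ M c d) _.
by exists p.
Qed.

Lemma near_cdom p c d : cdom c p -> cdom d p ->
  \forall x \near cmap c p, cdom d (cinv c x).
Proof.
move=> cp dp; apply: (cinv_continuous cp); apply: open_nbhs_nbhs.
by rewrite cmapK //; split=> //; exact: cdom_open.
Qed.

Lemma tangent_linear p (k : R) u v : tangent p u -> tangent p v ->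
  tangent p (k *: u + v).
Proof.
move=> [u0 uE] [v0 vE]; split=> [c ncp|c d cp dp].
  by rewrite !fctE u0 // v0 // scaler0 addr0.
rewrite !fctE (uE c d) // (vE c d) // !deriveE ?linearP //;
exact: transition_differentiable.
Qed.

Lemma tangent0 p : tangent p 0.
Proof.
split=> // c d cp dp; rewrite deriveE ?linear0 //.
exact: transition_differentiable.
Qed.

Lemma of_coordE p c d a : cdom d p ->
  of_coord c p a d = 'D_a (cmap d \o cinv c) (cmap c p).
Proof. by move=> dp; rewrite /of_coord (mem_set dp). Qed.

Lemma of_coord_out p c d a : ~ cdom d p -> of_coord c p a d = 0.
Proof. by move=> ndp; rewrite /of_coord (memNset ndp). Qed.

(** The transformation rule of a vector defined from its components in one chart
    is the chain rule applied to the cocycle identity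
    [cmap e \o cinv c = (cmap e \o cinv d) \o (cmap d \o cinv c)], which holds
    near the image of [p]. *)
Lemma of_coord_tangent p c a : cdom c p -> tangent p (of_coord c p a).
Proof.
move=> cp; split=> [d ndp|d e dp ep]; first exact: of_coord_out.
rewrite (of_coordE c a dp) (of_coordE c a ep).
have E : \forall x \near cmap c p,
    (cmap e \o cinv c) x = ((cmap e \o cinv d) \o (cmap d \o cinv c)) x.
  by apply: filterS (near_cdom cp dp) => x dx; rewrite /= cmapK.
have dcd := transition_differentiable cp dp.
have dde := transition_differentiable dp ep.
have dK : (cmap d \o cinv c) (cmap c p) = cmap d p by rewrite /= cmapK.
rewrite (near_eq_derive _ E) -dK; apply: derive_comp; first exact: dcd.
by rewrite dK; exact: dde.
Qed.

Lemma of_coord_linear p c (k : R) a b : cdom c p ->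
  of_coord c p (k *: a + b) = k *: of_coord c p a + of_coord c p b.
Proof.
move=> cp; apply/funext => d; rewrite !fctE.
have [dp|ndp] := pselect (cdom d p); last first.
  by rewrite (of_coord_out _ _ ndp) (of_coord_out _ a ndp) (of_coord_out _ b ndp)
    scaler0 addr0.
rewrite (of_coordE c _ dp) (of_coordE c a dp) (of_coordE c b dp).
have D := transition_differentiable cp dp.
by rewrite (deriveE _ D) (deriveE a D) (deriveE b D) linearP.
Qed.

Lemma of_coord0 p c : cdom c p -> of_coord c p 0 = 0.
Proof.
move=> cp; apply/funext => d; have [dp|ndp] := pselect (cdom d p).
  by rewrite (of_coordE c _ dp) derive0.
exact: of_coord_out.
Qed.

Lemma of_coordZ p c (k : R) a : cdom c p ->
  of_coord c p (k *: a) = k *: of_coord c p a.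
Proof.
move=> cp; rewrite -[in LHS](addr0 (k *: a)) (of_coord_linear _ _ _ cp).
by rewrite (of_coord0 cp) addr0.
Qed.

Lemma of_coordK p c u : cdom c p -> tangent p u -> of_coord c p (u c) = u.
Proof.
move=> cp [u0 uE]; apply/funext => d; have [dp|ndp] := pselect (cdom d p).
  by rewrite (of_coordE c _ dp) (uE c d).
by rewrite (of_coord_out _ _ ndp) (u0 _ ndp).
Qed.

Lemma of_coord_chart p c a : cdom c p -> of_coord c p a c = a.
Proof.
move=> cp; rewrite (of_coordE c a cp) -[RHS](derive_id (cmap c p)).
apply: near_eq_derive.
have Up : (cmap c @` cdom c) (cmap c p) by exists p.
apply: filterS (open_nbhs_nbhs (conj (@cimg_open _ _ M c) Up)) => _ [q cq <-].
by rewrite /= cmapK.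
Qed.

Lemma pushforward_tangent (F : 'rV[R]_2 -> M) (x a : 'rV[R]_2) :
  torus_embedding F -> tangent (F x) (Defs.pushforward F x a).
Proof.
move=> [cF sF _ _].
have pfE d : cdom d (F x) -> Defs.pushforward F x a d = 'D_a (cmap d \o F) x.
  by move=> dF; rewrite /Defs.pushforward (mem_set dF).
split=> [d ndF|c d cFx dFx]; first by rewrite /Defs.pushforward (memNset ndF).
rewrite (pfE _ cFx) (pfE _ dFx).
have E : \forall y \near x,
    (cmap d \o F) y = ((cmap d \o cinv c) \o (cmap c \o F)) y.
  have : nbhs x (F @^-1` cdom c).
    by apply: cF; apply: open_nbhs_nbhs; split=> //; exact: cdom_open.
  by apply: filterS => y cFy; rewrite /= cmapK.
rewrite (near_eq_derive _ E); apply: derive_comp.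
  exact: smooth_on_differentiable (sF c) _.
exact: transition_differentiable.
Qed.

Lemma torus_tangent_sub (F : 'rV[R]_2 -> M) p : torus_embedding F ->
  torus_tangent F p `<=` tangent p.
Proof. by move=> F_torus u [x [a [<- ->]]]; exact: pushforward_tangent. Qed.

End TangentVectors.

#[local] Opaque tangent.

(** * Metrics in coordinates *)

Section MetricCoordinates.
Context {R : realType} {n : nat} {M : manifold R n}.
Variables (g : tensor2 M) (g_metric : riemannian_metric g).
Implicit Types (p : M) (c d : chart M) (u v w : tvec M) (a b : 'rV[R]_n).

Lemma tangent_subspace p : subspace (tangent p : set (tvec M)).
Proof. by split=> [|k u v]; [exact: tangent0 | exact: tangent_linear]. Qed.

(** This is the bridge through which the pointwise linear algebra applies to
    tangent spaces. *)
Lemma metric_ip p : inner_product (tangent p) (g p).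
Proof.
case: g_metric => gl gC g0 _; split.
- exact: tangent_subspace.
- by move=> k u v w; exact: gl.
- by move=> u v; exact: gC.
- by move=> u; exact: g0.
Qed.

Lemma row_linear_sum (phi : 'rV[R]_n -> R) a :
  (forall (k : R) x y, phi (k *: x + y) = k * phi x + phi y) ->
  phi a = \sum_(i < n) a 0 i * phi (delta_mx 0 i).
Proof.
move=> phi_lin.
pose phiM := GRing.isLinear.Build _ _ _ _ phi phi_lin.
pose phiL : {linear _ -> _} := HB.pack phi phiM.
have -> : phi = phiL by [].
rewrite {1}[a]row_sum_delta linear_sum; apply: eq_bigr => i _.
exact: linearZ.
Qed.

Definition metric_coef c (i j : 'I_n) p : R :=
  g p (of_coord c p (delta_mx 0 i)) (of_coord c p (delta_mx 0 j)).

Lemma metric_coordE c p a b : cdom c p ->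
  g p (of_coord c p a) (of_coord c p b)
  = \sum_(i < n) \sum_(j < n) a 0 i * (b 0 j * metric_coef c i j p).
Proof.
move=> cp; have ip := metric_ip p; have oT a' := of_coord_tangent a' cp.
rewrite (@row_linear_sum (fun a => g p (of_coord c p a) (of_coord c p b))).
  apply: eq_bigr => i _; rewrite -mulr_sumr; congr (_ * _).
  rewrite (@row_linear_sum (fun b =>
    g p (of_coord c p (delta_mx 0 i)) (of_coord c p b))).
    by apply: eq_bigr.
  move=> k x y; rewrite (of_coord_linear _ _ _ cp).
  rewrite (ipDr ip) ?(ipZr ip); auto.
  exact: subspaceZ (tangent_subspace p) _ _ (oT _).
move=> k x y; rewrite (of_coord_linear _ _ _ cp).
exact: (ipPl ip _ (oT _) (oT _) (oT _)).
Qed.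

End MetricCoordinates.

Section MetricContinuity.
Context {R : realType} {n : nat} {M : manifold R n}.

Lemma metric_coef_continuous (g : tensor2 M) c i j p : riemannian_metric g ->
  cdom c p -> {for p, continuous (metric_coef g c i j)}.
Proof.
move=> g_metric cp; have Up : (cmap c @` cdom c) (cmap c p) by exists p.
have [_ _ _ /(_ c i j) /(_ 0 _ Up)] := g_metric.
move=> ch; pose h x := metric_coef g c i j (cinv c x).
have E : \forall q \near p, h (cmap c q) = metric_coef g c i j q.
  apply: filterS (open_nbhs_nbhs (conj (@cdom_open _ _ M c) cp)) => q cq.
  by rewrite /h cmapK.
rewrite /prop_for /continuous_at -(nbhs_singleton E).
apply: cvg_trans (near_eq_cvg E) _.
exact: (continuous_comp (cmap_continuous cp) ch).
Qed.

(** The squared length of the vector at [z.1] with components [z.2] in the chart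
    [c], as a function of both variables jointly. *)
Definition metric_quad (g : tensor2 M) (c : chart M) (z : M * 'rV[R]_n) : R :=
  \sum_(i < n) \sum_(j < n) z.2 0 i * (z.2 0 j * metric_coef g c i j z.1).

Lemma metric_quad_continuous (g : tensor2 M) c p a : riemannian_metric g ->
  cdom c p -> {for (p, a), continuous (metric_quad g c)}.
Proof.
move=> g_metric cp; rewrite /prop_for /continuous_at.
have coord i : (fun z : M * 'rV[R]_n => z.2 0 i : R) @ (p, a) --> a 0 i.
  apply: (@cvg_comp _ _ _ snd (fun b : 'rV[R]_n => b 0 i) _ (nbhs a)).
    exact: cvg_snd.
  exact: coord_continuous.
have coef i j : (fun z : M * 'rV[R]_n => metric_coef g c i j z.1) @ (p, a)
    --> metric_coef g c i j p.
  apply: (@cvg_comp _ _ _ fst (metric_coef g c i j) _ (nbhs p)).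
    exact: cvg_fst.
  exact: metric_coef_continuous.
apply: cvg_big => [|i _]; first exact: add_continuous.
apply: cvg_big => [|j _]; first exact: add_continuous.
exact: cvgM (coord i) (cvgM (coord j) (coef i j)).
Qed.

End MetricContinuity.

(** * Vector fields and Levi-Civita connections *)

Section VectorFields.
Context {R : realType} {n : nat} {M : manifold R n}.
Implicit Types (X Y Z W : vfield M) (p : M) (c : chart M).

Lemma vector_field_linear (k : R) X Y : vector_field X -> vector_field Y ->
  vector_field (fun p => k *: X p + Y p).
Proof.
move=> [tX sX] [tY sY]; split=> [p|c]; first exact: tangent_linear.
exact: (smooth_on_linear k (@cimg_open _ _ M c) (sX c) (sY c)).
Qed.

Lemma vector_fieldB X Y : vector_field X -> vector_field Y ->
  vector_field (fun p => X p - Y p).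
Proof.
move=> vX vY; rewrite (_ : (fun _ => _) = fun p => (-1) *: Y p + X p).
  exact: vector_field_linear.
by apply/funext => p; rewrite scaleN1r addrC.
Qed.

Lemma vector_fieldZ (k : R) X : vector_field X ->
  vector_field (fun p => k *: X p).
Proof.
move=> vX; rewrite (_ : (fun _ => _) = fun p => (k - 1) *: X p + X p).
  exact: vector_field_linear.
by apply/funext => p; rewrite scalerBl scale1r subrK.
Qed.

Lemma vector_field_tIP P (t : R) X : endo_field P -> vector_field X ->
  vector_field (fun p => tIP P t p (X p)).
Proof.
move=> [_ _ vP] vX.
exact: (vector_fieldZ t (vector_fieldB vX (vP X vX))).
Qed.

Lemma vector_field_iter_tIP P (t : R) X k : endo_field P -> vector_field X ->
  vector_field (fun p => iter k (tIP P t p) (X p)).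
Proof.
move=> endoP vX; elim: k => // k IH.
exact: (vector_field_tIP t endoP IH).
Qed.

Lemma dirder_linear c X (a b : R) (f h : M -> R) p :
  differentiable (f \o cinv c) (cmap c p) ->
  differentiable (h \o cinv c) (cmap c p) ->
  dirder c X (fun q => a * f q + b * h q) p
  = a * dirder c X f p + b * dirder c X h p.
Proof.
move=> /(@diff_derivable _ _ _ _ _ (X p c)) df.
move=> /(@diff_derivable _ _ _ _ _ (X p c)) dh.
apply: etrans (deriveD (derivableZ (k := a) df) (derivableZ (k := b) dh)) _.
exact: (congr2 +%R (deriveZ a df) (deriveZ b dh)).
Qed.

(** Near a point of the domain of [c], [g Y Z] is a polynomial expression in the
    components of [Y] and [Z] and in the coefficients of the metric in [c]. *)
Lemma metric_pairing_differentiable (g : tensor2 M) Y Z c p :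
  riemannian_metric g -> vector_field Y -> vector_field Z -> cdom c p ->
  differentiable ((fun q => g q (Y q) (Z q)) \o cinv c) (cmap c p).
Proof.
move=> g_metric [tY sY] [tZ sZ] cp.
have Up : (cmap c @` cdom c) (cmap c p) by exists p.
pose y (i : 'I_n) x : R := Y (cinv c x) c 0 i.
pose z (i : 'I_n) x : R := Z (cinv c x) c 0 i.
pose h i j x : R := metric_coef g c i j (cinv c x).
have coordD (S : vfield M) i :
    smooth_on (cmap c @` cdom c) (fun x => S (cinv c x) c) ->
    differentiable (fun x => S (cinv c x) c 0 i : R) (cmap c p).
  move=> /smooth_on_differentiable-/(_ _ Up) dS.
  exact: (differentiable_comp dS (differentiable_coord _ _ _)).
have dy i : differentiable (y i) (cmap c p) by exact: coordD.
have dz i : differentiable (z i) (cmap c p) by exact: coordD.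
have dh i j : differentiable (h i j) (cmap c p).
  case: g_metric => _ _ _ /(_ c i j) sg.
  exact: (smooth_on_differentiable sg Up).
apply: (@near_eq_differentiable _ _ _
  (\sum_(i < n) \sum_(j < n) (y i * (z j * h i j)))); last first.
  apply: differentiable_sum => i; apply: differentiable_sum => j.
  exact: (differentiableM (dy i) (differentiableM (dz j) (dh i j))).
apply: filterS (open_nbhs_nbhs (conj (@cimg_open _ _ M c) Up)) => _ [q cq <-] /=.
rewrite cmapK // -(of_coordK cq (tY q)) -(of_coordK cq (tZ q)).
rewrite (metric_coordE g_metric _ _ cq) fct_sumE; apply: eq_bigr => i _.
rewrite fct_sumE; apply: eq_bigr => j _.
by rewrite !fctE /y /z /h (cmapK cq).
Qed.

End VectorFields.

Section LeviCivita.
Context {R : realType} {n : nat} {M : manifold R n}.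
Variables (g : tensor2 M) (nabla : vfield M -> vfield M -> vfield M).
Hypotheses (g_metric : riemannian_metric g) (LC : levi_civita g nabla).
Implicit Types (X Y Z W : vfield M) (p : M) (c : chart M).

Lemma vector_field_nabla X Y : vector_field X -> vector_field Y ->
  vector_field (nabla X Y).
Proof. by case: LC => -[vN _ _ _] _ _; exact: vN. Qed.

(** Torsion-freeness is used in this form: it gives the smoothness of the
    bracket without any computation with second derivatives. *)
Lemma bracketE X Y : vector_field X -> vector_field Y ->
  bracket X Y = (fun p => nabla X Y p - nabla Y X p).
Proof. by case: LC => _ tor _ vX vY; apply/funext => p; rewrite tor. Qed.

Lemma vector_field_bracket X Y : vector_field X -> vector_field Y ->
  vector_field (bracket X Y).
Proof.
move=> vX vY; rewrite (bracketE vX vY).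
by apply: vector_fieldB; exact: vector_field_nabla.
Qed.

Lemma metric_compatible c X Y Z p :
  vector_field X -> vector_field Y -> vector_field Z -> cdom c p ->
  dirder c X (fun q => g q (Y q) (Z q)) p
  = g p (nabla X Y p) (Z p) + g p (Y p) (nabla X Z p).
Proof. by case: LC => _ _ compat *; exact: compat. Qed.

(** The right-hand side does not involve the connection, and depends linearly on
    the metric as soon as the derivatives exist. *)
Lemma koszul c X Y Z p :
  vector_field X -> vector_field Y -> vector_field Z -> cdom c p ->
  2 * g p (nabla X Y p) (Z p)
  = dirder c X (fun q => g q (Y q) (Z q)) p
    + dirder c Y (fun q => g q (X q) (Z q)) p
    - dirder c Z (fun q => g q (X q) (Y q)) p
    + g p (bracket X Y p) (Z p) - g p (bracket X Z p) (Y p)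
    - g p (bracket Y Z p) (X p).
Proof.
move=> vX vY vZ cp; have ip := metric_ip g_metric p.
have tN A B : vector_field A -> vector_field B -> tangent p (nabla A B p).
  by move=> vA vB; case: (vector_field_nabla vA vB).
have [/(_ p) tX _] := vX; have [/(_ p) tY _] := vY; have [/(_ p) tZ _] := vZ.
have tXY := tN _ _ vX vY; have tYX := tN _ _ vY vX; have tXZ := tN _ _ vX vZ.
have tZX := tN _ _ vZ vX; have tYZ := tN _ _ vY vZ; have tZY := tN _ _ vZ vY.
rewrite (metric_compatible vX vY vZ cp) (metric_compatible vY vX vZ cp).
rewrite (metric_compatible vZ vX vY cp).
rewrite (bracketE vX vY) (bracketE vX vZ) (bracketE vY vZ).
rewrite (ipBl ip tXY tYX tZ) (ipBl ip tXZ tZX tY) (ipBl ip tYZ tZY tX).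
rewrite (ipC ip tY tXZ) (ipC ip tX tYZ) (ipC ip tX tZY).
ring.
Qed.

(** Integration of the two outer covariant derivatives by metric compatibility:
    curvature is made of terms linear in the pairings [g (nabla A B) C], and of
    a quadratic term in the connection. *)
Lemma curvatureE c X Y Z W p :
  vector_field X -> vector_field Y -> vector_field Z -> vector_field W ->
  cdom c p ->
  curvature g nabla X Y Z W p
  = dirder c X (fun q => g q (nabla Y Z q) (W q)) p
    - dirder c Y (fun q => g q (nabla X Z q) (W q)) p
    - g p (nabla (bracket X Y) Z p) (W p)
    - (g p (nabla Y Z p) (nabla X W p) - g p (nabla X Z p) (nabla Y W p)).
Proof.
move=> vX vY vZ vW cp; have ip := metric_ip g_metric p.
have vXZ := vector_field_nabla vX vZ; have vYZ := vector_field_nabla vY vZ.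
have vB := vector_field_bracket vX vY.
have [tXYZ _] := vector_field_nabla vX vYZ.
have [tYXZ _] := vector_field_nabla vY vXZ.
have [tBZ _] := vector_field_nabla vB vZ.
have [tW _] := vW; have T_sub := tangent_subspace p.
rewrite /curvature (ipBl ip (subspaceB T_sub (tXYZ p) (tYXZ p)) (tBZ p) (tW p)).
rewrite (ipBl ip (tXYZ p) (tYXZ p) (tW p)).
rewrite (metric_compatible vX vYZ vW cp) (metric_compatible vY vXZ vW cp).
ring.
Qed.

End LeviCivita.

(** * The segment between two metrics *)

Section MetricPath.
Context {R : realType} {n : nat} {M : manifold R n}.
Variables (g0 g1 : tensor2 M).
Hypotheses (g0_metric : riemannian_metric g0) (g1_metric : riemannian_metric g1).
Variables (t : R) (t01 : 0 <= t <= 1).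
Let gt := metric_path g0 g1 t.

(** Positivity is where [t] has to lie in the unit interval. *)
Lemma metric_path_metric : riemannian_metric gt.
Proof.
have [t0 t1] := andP t01; split.
- move=> p u v w a tu tv tw; rewrite /gt /metric_path.
  rewrite (ipPl (metric_ip g0_metric p)) // (ipPl (metric_ip g1_metric p)) //.
  ring.
- move=> p u v tu tv; rewrite /gt /metric_path.
  by rewrite (ipC (metric_ip g0_metric p)) // (ipC (metric_ip g1_metric p)).
- move=> p u tu u0; rewrite /gt /metric_path.
  have [_ _ /(_ p u tu u0) g0u _] := g0_metric.
  have [_ _ /(_ p u tu u0) g1u _] := g1_metric.
  have [->|tn0] := eqVneq t 0; first by rewrite subr0 mul1r mul0r addr0.
  have tpos : 0 < t by rewrite lt_neqAle eq_sym tn0.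
  by rewrite ltr_wpDl ?mulr_gt0 // mulr_ge0 ?subr_ge0 // ltW.
- move=> c i j; have [_ _ _ /(_ c i j) s0] := g0_metric.
  have [_ _ _ /(_ c i j) s1] := g1_metric.
  have oU := @cimg_open _ _ M c.
  have := smooth_on_linear t oU (smooth_on_linear (-1) oU s0 s1) s0.
  congr smooth_on; apply/funext => x; rewrite /gt /metric_path /=.
  by rewrite /GRing.scale /=; ring.
Qed.

Variables (nabla0 nabla1 nablat : vfield M -> vfield M -> vfield M).
Hypotheses (LC0 : levi_civita g0 nabla0) (LC1 : levi_civita g1 nabla1).
Hypothesis LCt : levi_civita gt nablat.
Implicit Types (X Y Z W : vfield M) (p : M) (c : chart M).

Lemma dirder_metric_path c X Y Z p :
  vector_field Y -> vector_field Z -> cdom c p ->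
  dirder c X (fun q => gt q (Y q) (Z q)) p
  = (1 - t) * dirder c X (fun q => g0 q (Y q) (Z q)) p
    + t * dirder c X (fun q => g1 q (Y q) (Z q)) p.
Proof.
move=> vY vZ cp; apply: dirder_linear;
exact: metric_pairing_differentiable.
Qed.

(** Both sides are given by Koszul's formula, which is linear in the metric. The
    connections themselves are not affine in [t]; these pairings are. *)
Lemma metric_path_nabla X Y Z p :
  vector_field X -> vector_field Y -> vector_field Z ->
  gt p (nablat X Y p) (Z p)
  = (1 - t) * g0 p (nabla0 X Y p) (Z p) + t * g1 p (nabla1 X Y p) (Z p).
Proof.
move=> vX vY vZ; have [c cp] := mfd_cover p.
apply: (@mulfI _ 2) => //.
rewrite (koszul metric_path_metric LCt vX vY vZ cp).
rewrite (dirder_metric_path X vY vZ cp) (dirder_metric_path Y vX vZ cp).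
rewrite (dirder_metric_path Z vX vY cp) mulrDr !mulrA ![2 * _]mulrC -!mulrA.
rewrite (koszul g0_metric LC0 vX vY vZ cp) (koszul g1_metric LC1 vX vY vZ cp).
rewrite /gt /metric_path; ring.
Qed.

(** In [curvatureE], the terms that are not quadratic are affine in [t] by
    [metric_path_nabla], so they cancel. The quadratic term features
    [nabla Y X] rather than [nabla X Y]; the difference is a pairing with the
    bracket, [g (nabla X Y) [X, Y]], again affine in [t]. *)
Lemma metric_path_curvature X Y p : vector_field X -> vector_field Y ->
  let q (g : tensor2 M) nabla := g p (nabla X X p) (nabla Y Y p)
                     - g p (nabla X Y p) (nabla X Y p) in
  curvature gt nablat X Y Y X p
  = (1 - t) * curvature g0 nabla0 X Y Y X p + t * curvature g1 nabla1 X Y Y X p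
    + (1 - t) * q g0 nabla0 + t * q g1 nabla1 - q gt nablat.
Proof.
move=> vX vY q; have [c cp] := mfd_cover p.
have vB := vector_field_bracket LC0 vX vY.
have linear_part (A B Z W : vfield M) : vector_field A -> vector_field B ->
    vector_field Z -> vector_field W ->
    dirder c A (fun r => gt r (nablat B Z r) (W r)) p
    = (1 - t) * dirder c A (fun r => g0 r (nabla0 B Z r) (W r)) p
      + t * dirder c A (fun r => g1 r (nabla1 B Z r) (W r)) p.
  move=> vA vB' vZ vW.
  rewrite -dirder_linear; last 2 first.
  - exact: (metric_pairing_differentiable g0_metric
      (vector_field_nabla LC0 vB' vZ) vW cp).
  - exact: (metric_pairing_differentiable g1_metric
      (vector_field_nabla LC1 vB' vZ) vW cp).
  congr (dirder c A _ p); apply/funext => r.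
  exact: metric_path_nabla vB' vZ vW.
have crossE (g : tensor2 M) nabla : riemannian_metric g -> levi_civita g nabla ->
    g p (nabla Y Y p) (nabla X X p) - g p (nabla X Y p) (nabla Y X p)
    = q g nabla + g p (nabla X Y p) (bracket X Y p).
  move=> gm LC; have ip := metric_ip gm p.
  have [tXX _] := vector_field_nabla LC vX vX.
  have [tYY _] := vector_field_nabla LC vY vY.
  have [tXY _] := vector_field_nabla LC vX vY.
  have [tYX _] := vector_field_nabla LC vY vX.
  rewrite (bracketE LC vX vY) (ipBr ip (tXY p) (tYX p) (tXY p)).
  by rewrite (ipC ip (tYY p) (tXX p)) /q; ring.
(* all the remaining discrepancies are affine in [t] and cancel *)
rewrite (curvatureE metric_path_metric LCt vX vY vY vX cp).
rewrite (curvatureE g0_metric LC0 vX vY vY vX cp).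
rewrite (curvatureE g1_metric LC1 vX vY vY vX cp).
rewrite (crossE _ _ metric_path_metric LCt) (crossE _ _ g0_metric LC0).
rewrite (crossE _ _ g1_metric LC1).
rewrite (linear_part X Y Y X) // (linear_part Y X Y X) //.
rewrite (metric_path_nabla _ vB vY vX) (metric_path_nabla _ vX vY vB).
ring.
Qed.

End MetricPath.

(** * Operator norms on a compact manifold *)

Section OperatorNorm.
Context {R : realType} {n : nat} {M : manifold R n}.
Variables (g : tensor2 M) (p : M) (A : tvec M -> tvec M).
Hypothesis g_metric : riemannian_metric g.

(** The constant [q] is the square of the operator norm; homogeneity reduces the
    bound to unit vectors, over which the norm is a supremum. *)
Lemma opnorm_lt1_contraction :
  (forall u, tangent p u -> tangent p (A u)) ->
  (forall k u, tangent p u -> A (k *: u) = k *: A u) ->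
  (opnorm g p A < 1)%E ->
  exists2 q : R, 0 <= q < 1 &
    forall u, tangent p u -> g p (A u) (A u) <= q * g p u u.
Proof.
move=> tA AZ; have ip := metric_ip g_metric p.
have A0 : A 0 = 0.
  by rewrite -[X in A X](scale0r (0 : tvec M)) AZ ?scale0r //; exact: tangent0.
set S := opnorm g p A => S1.
have ub u : tangent p u -> Defs.gnorm g p u <= 1 ->
    ((Defs.gnorm g p (A u))%:E <= S)%E.
  by move=> tu u1; apply: ereal_sup_ubound; exists u.
have S0 : (0 <= S)%E.
  have := ub 0 (tangent0 p); rewrite A0 /Defs.gnorm (ip0l ip (tangent0 p)) sqrtr0.
  by apply; exact: ler01.
have Sfin : S \is a fin_num by rewrite ge0_fin_numE // (lt_trans S1) // ltry.
have fS0 : 0 <= fine S by exact: fine_ge0.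
have fS1 : fine S < 1 by rewrite -lte_fin fineK.
exists (fine S ^+ 2).
  by rewrite exprn_ge0 //= expr_lt1.
move=> u tu; have g0 := ip_ge0 ip tu.
have [u0|/eqP u0] := eqVneq u 0.
  by rewrite u0 A0 (ip0l ip (tangent0 p)) mulr0.
have gpos : 0 < g p u u by case: ip => _ _ _; exact.
pose s := Num.sqrt (g p u u); have s0 : 0 < s by rewrite sqrtr_gt0.
have s2 : s ^+ 2 = g p u u by rewrite sqr_sqrtr.
have tsu : tangent p (s^-1 *: u) by exact: (subspaceZ (tangent_subspace p)).
have := ub _ tsu; rewrite AZ // /Defs.gnorm.
have tAu := tA _ tu.
rewrite (ipZZ ip _ tu) (ipZZ ip _ tAu) -s2 -exprMn mulVf ?gt_eqF //.
rewrite expr1n sqrtr1 => /(_ (lexx _)) H.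
have gA := ip_ge0 ip tAu.
have H2 : s^-1 ^+ 2 * g p (A u) (A u) <= fine S ^+ 2.
  rewrite -[leLHS]sqr_sqrtr; last by rewrite mulr_ge0 // sqr_ge0.
  by rewrite ler_sqr ?nnegrE ?sqrtr_ge0 // -lee_fin fineK.
by rewrite s2 -ler_pdivrMr // mulrC -s2 -exprVn.
Qed.

Lemma opnorm_le (q : R) : 0 <= q ->
  (forall u, tangent p u -> g p (A u) (A u) <= q ^+ 2 * g p u u) ->
  (opnorm g p A <= q%:E)%E.
Proof.
move=> q0 Aq; apply: ge_ereal_sup => _ /= [u [tu u1] <-].
rewrite lee_fin; apply: le_trans (ler_wsqrtr (Aq u tu)) _.
by rewrite sqrtrM ?exprn_ge0 // sqrtr_sqr ger0_norm // ler_piMr.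
Qed.

End OperatorNorm.

Section Compactness.
Context {R : realType} {n : nat} {M : manifold R n}.
Variables (g0 g1 : tensor2 M).
Hypotheses (g0_metric : riemannian_metric g0) (g1_metric : riemannian_metric g1).

Lemma metric_quadE (g : tensor2 M) c p a : riemannian_metric g -> cdom c p ->
  metric_quad g c (p, a) = g p (of_coord c p a) (of_coord c p a).
Proof. by move=> gm cp; rewrite (metric_coordE gm a a cp). Qed.

Lemma metric_quad_gt0 (g : tensor2 M) c p a : riemannian_metric g ->
  cdom c p -> a != 0 -> 0 < metric_quad g c (p, a).
Proof.
move=> gm cp a0; rewrite (metric_quadE a gm cp).
have [_ _ _ gpos] := metric_ip gm p; apply: gpos; first exact: of_coord_tangent.
by move=> /(congr1 (@^~ c)); rewrite /= (of_coord_chart a cp) => /eqP; exact/negP.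
Qed.

Lemma compact_unit_sphere : compact [set a : 'rV[R]_n | `|a| = 1].
Proof.
apply: bounded_closed_compact.
  by exists 1; split=> // x x1 a /= ->; exact: ltW.
rewrite (_ : mkset _ = Num.norm @^-1` [set 1 : R]) //.
apply: closed_comp; last exact: closed_eq.
by move=> a _; exact: norm_continuous.
Qed.

(** Near each pair of [p0] and a unit coordinate vector, joint continuity bounds
    the ratio of the two quadratic forms by its value at that pair plus 1.
    Compactness of the unit sphere makes the bound and the neighborhood of [p0]
    uniform in the vector, and homogeneity extends it to all tangent vectors. *)
Lemma locally_dominated (p0 : M) :
  \forall p \near p0 & C \near pinfty_nbhs R,
    forall u, tangent p u -> g1 p u u <= C * g0 p u u.
Proof.
have [c cp0] := mfd_cover p0.
have sphere_bound : \forall pC \near filter_prod (nbhs p0) (pinfty_nbhs R),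
    [set a : 'rV[R]_n | `|a| = 1] `<=`
    [set a | metric_quad g1 c (pC.1, a) <= pC.2 * metric_quad g0 c (pC.1, a)].
  have /compact_near_coveringP := compact_unit_sphere.
  apply => a0 a01.
  have a0n0 : a0 != 0 by rewrite -normr_gt0 a01.
  have q0 := metric_quad_gt0 g0_metric cp0 a0n0.
  (* the ratio at (p0, a0), increased by 1 to make the inequality strict *)
  pose K := metric_quad g1 c (p0, a0) / metric_quad g0 c (p0, a0) + 1.
  have q0c := @metric_quad_continuous _ _ _ g0 c p0 a0 g0_metric cp0.
  have q1c := @metric_quad_continuous _ _ _ g1 c p0 a0 g1_metric cp0.
  have dc : (fun z => K * metric_quad g0 c z - metric_quad g1 c z) @ (p0, a0)
      --> K * metric_quad g0 c (p0, a0) - metric_quad g1 c (p0, a0).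
    exact: (cvgB (cvgM (cvg_cst K) q0c) q1c).
  have d0 : 0 < K * metric_quad g0 c (p0, a0) - metric_quad g1 c (p0, a0).
    by rewrite /K mulrDl mul1r divfK ?gt_eqF // addrAC subrr add0r.
  have [[U V] /= [nU nV] UV] : nbhs (p0, a0) [set z |
      0 < metric_quad g0 c z /\ 0 < K * metric_quad g0 c z - metric_quad g1 c z].
    apply: filterI; first exact: cvgr_gt q0c _ q0.
    exact: cvgr_gt dc _ d0.
  exists (V, U `*` [set C | K <= C]).
    split=> //=; exists (U, [set C | K <= C]) => //; split=> //=.
    exact: nbhs_pinfty_ge (num_real K).
  move=> [a [p C]] /= [Va [Up KC]].
  have [/= qz dz] := UV (p, a) (conj Up Va).
  rewrite subr_gt0 in dz; apply: le_trans (ltW dz) _.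
  exact: ler_wpM2r (ltW qz) _ _ KC.
have [[U W] /= [nU nW] UW] := sphere_bound.
exists (U `&` cdom c, W).
  split=> //=; apply: filterI => //; apply: open_nbhs_nbhs; split => //.
  exact: cdom_open.
move=> [p C] /= [[Up cp] WC] u tu.
have [u0|un0] := eqVneq (u c) 0.
  have -> : u = 0 by rewrite -(of_coordK cp tu) u0 (of_coord0 cp).
  by rewrite (ip0l (metric_ip g0_metric p) (tangent0 p))
    (ip0l (metric_ip g1_metric p) (tangent0 p)) mulr0.
have nu : 0 < `|u c| by rewrite normr_gt0.
pose a := `|u c|^-1 *: u c.
have a1 : `|a| = 1 by rewrite normrZ normfV normr_id mulVf ?gt_eqF.
have uE : u = `|u c| *: of_coord c p a.
  rewrite -(of_coordZ _ _ cp) /a scalerA divff ?gt_eqF // scale1r.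
  by rewrite (of_coordK cp tu).
have ta := of_coord_tangent a cp.
rewrite uE (ipZZ (metric_ip g0_metric p) _ ta) (ipZZ (metric_ip g1_metric p) _ ta).
rewrite mulrCA ler_pM2l ?exprn_gt0 //.
have := UW (p, C) (conj Up WC) a a1.
by rewrite /= (metric_quadE a g0_metric cp) (metric_quadE a g1_metric cp).
Qed.

Lemma metric_dominated : compact [set: M] ->
  exists2 C : R, 0 <= C &
    forall p u, tangent p u -> g1 p u u <= C * g0 p u u.
Proof.
move=> /compact_near_coveringP cM.
have H : \forall C \near pinfty_nbhs R, [set: M] `<=`
    [set p | forall u, tangent p u -> g1 p u u <= C * g0 p u u].
  by apply: cM => p _; exact: locally_dominated.
have [C [C0 HC]] := filter_ex (filterI (nbhs_pinfty_ge (num_real (0 : R))) H).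
by exists C => // p; exact: HC.
Qed.

(** If [g1 <= C g0] then Cauchy-Schwarz for [g1] gives
    [g0 (P u) (P u) = g1 u (P u) <= C |u| |P u|] in [g0]-norms, so that
    [|P u| <= C |u|]. Hence [I - P] is bounded uniformly on [M]. *)
Lemma opnorm_tIP_lt1 (P : M -> tvec M -> tvec M) : compact [set: M] ->
  endo_field P ->
  (forall p u v, tangent p u -> tangent p v -> g0 p (P p u) v = g1 p u v) ->
  exists2 e : R, 0 < e & forall t : R, 0 <= t <= 1 -> t < e ->
     forall p, (opnorm g0 p (tIP P t p) < 1)%E.
Proof.
move=> cM [tP _ _] P_def; have [C C0 dom] := metric_dominated cM.
(* [L] bounds the square of the norm of [I - P]; it is at least 1, so it also
   bounds the norm itself *)
pose L := 2 + 2 * C ^+ 2.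
have L1 : 1 <= L by rewrite /L; have := sqr_ge0 C; lra.
have L0 : 0 < L by exact: lt_le_trans L1.
exists L^-1; first by rewrite invr_gt0.
move=> t /andP[t0 _] tL p.
have tL1 : t * L < 1 by rewrite -ltr_pdivlMr // div1r.
apply: le_lt_trans (_ : (t * L)%:E < 1)%E; last by rewrite lte_fin.
apply: opnorm_le; first by rewrite mulr_ge0 // ltW.
move=> u tu; have ip := metric_ip g0_metric p; have ip1 := metric_ip g1_metric p.
have tPu := tP p u tu; have Ts := tangent_subspace p.
have tuP := subspaceB Ts tu tPu.
rewrite /tIP (ipZZ ip _ tuP) exprMn -[leRHS]mulrA ler_wpM2l ?sqr_ge0 //.
have Pbound : g0 p (P p u) (P p u) <= C ^+ 2 * g0 p u u.
  have x0 := ip_ge0 ip tPu; have y0 := ip_ge0 ip tu.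
  have := ip_cauchy_schwarz ip1 tu tPu; rewrite -P_def // => cs.
  have du := dom p u tu; have dPu := dom p (P p u) tPu.
  have z0 := ip_ge0 ip1 tu; have w0 := ip_ge0 ip1 tPu.
  move: (g0 p (P p u) (P p u)) (g0 p u u) x0 y0 cs du dPu z0 w0.
  move=> x y x0 y0 cs du dPu z0 w0.
  have xx : x * x <= x * (C ^+ 2 * y).
    rewrite -expr2; apply: le_trans cs _.
    apply: le_trans (ler_pM z0 w0 du dPu) _.
    by rewrite le_eqVlt; apply/orP; left; apply/eqP; ring.
  have [->|xn0] := eqVneq x 0; first by rewrite mulr_ge0 ?sqr_ge0.
  by rewrite -(@ler_pM2l _ x) // lt_neqAle eq_sym xn0.
have psum := ip_ge0 ip (subspaceD Ts tu tPu).
have tD := subspaceD Ts tu tPu.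
rewrite (ipDl ip tu tPu tD) (ipDr ip tu tPu tu) (ipDr ip tu tPu tPu) in psum.
rewrite (ipBl ip tu tPu tuP) (ipBr ip tu tPu tu) (ipBr ip tu tPu tPu).
have gu := ip_ge0 ip tu.
apply: (@le_trans _ _ (L * g0 p u u)); first by rewrite /L; lra.
by rewrite ler_wpM2r // expr2 ler_peMl // ltW.
Qed.

End Compactness.

(** * The curvature along the torus *)

Theorem lemma4 (R : realType) (n : nat) (M : manifold R n)
  (g0 g1 : tensor2 M) (nabla0 nabla1 : vfield M -> vfield M -> vfield M)
  (F : 'rV[R]_2 -> M) (P : M -> tvec M -> tvec M)
  (top perp : M -> tvec M -> tvec M) (X Y : vfield M)
  (M_closed : compact [set: M])
  (g0_metric : riemannian_metric g0) (g1_metric : riemannian_metric g1)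
  (nabla0_LC : levi_civita g0 nabla0) (nabla1_LC : levi_civita g1 nabla1)
  (F_torus : torus_embedding F)
  (F_geodesic : totally_geodesic F nabla0) (F_flat : flat_torus F g0)
  (P_endo : endo_field P)
  (P_def : forall p u v, tangent p u -> tangent p v ->
     g0 p (P p u) v = g1 p u v)
  (top_proj : forall p, range F p ->
     orth_proj g1 p (torus_tangent F p) (top p))
  (perp_proj : forall p, range F p ->
     orth_proj g1 p (orth_compl g1 p (torus_tangent F p)) (perp p))
  (X_field : vector_field X) (Y_field : vector_field Y)
  (X_tangent : tangent_to_torus F X) (Y_tangent : tangent_to_torus F Y)
  (nabla0_XX : forall p, range F p -> nabla0 X X p = 0)
  (nabla0_XY : forall p, range F p -> nabla0 X Y p = 0)
  (nabla0_YY : forall p, range F p -> nabla0 Y Y p = 0) :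
  (exists2 e : R, 0 < e & forall t : R, 0 <= t <= 1 -> t < e ->
     forall p, (opnorm g0 p (tIP P t p) < 1)%E) /\
  (forall (t : R) (nablat : vfield M -> vfield M -> vfield M),
     0 <= t <= 1 -> levi_civita (metric_path g0 g1 t) nablat ->
     forall p, range F p -> (opnorm g0 p (tIP P t p) < 1)%E ->
     let a := nabla1 X X p in
     let b := nabla1 X Y p in
     let c := nabla1 Y Y p in
     let term := fun k : nat =>
       g1 p (P p (iter k.-1 (tIP P t p) a)) c
       - g1 p (P p (iter k.-1 (tIP P t p) b)) b in
     let partial_sum := fun N : nat => \sum_(1 <= k < N) term k in
     cvgn partial_sum /\
     curvature (metric_path g0 g1 t) nablat X Y Y X p
     = (1 - t) * curvature g0 nabla0 X Y Y X p
       + t * curvature g1 nabla1 X Y Y X p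
       + t * (g1 p (perp p a) (perp p c) - g1 p (perp p b) (perp p b))
       + t * (g1 p (top p a) (top p c) - g1 p (top p b) (top p b))
       - t ^+ 2 * limn partial_sum).
Proof.
split; first exact: opnorm_tIP_lt1 g0_metric g1_metric P M_closed P_endo P_def.
move=> t nablat t01 LCt p Fp Anorm a b c term partial_sum.
have vN1 A B := @vector_field_nabla _ _ _ _ _ nabla1_LC A B.
have vNt A B := @vector_field_nabla _ _ _ _ _ LCt A B.
have ip0 := metric_ip g0_metric p; have ip1 := metric_ip g1_metric p.
have [tP PZ vP] := P_endo.
have Ts := tangent_subspace p.
have [q /andP[q0 q1] A_contr] : exists2 q : R, 0 <= q < 1 &
    forall u, tangent p u ->
      g0 p (tIP P t p u) (tIP P t p u) <= q * g0 p u u.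
  apply: opnorm_lt1_contraction Anorm => // [u tu|k u tu].
    by apply: (subspaceZ Ts); apply: (subspaceB Ts) => //; exact: tP.
  have PZu : P p (k *: u) = k *: P p u.
    have P00 : P p 0 = 0.
      have := PZ p 1 0 0 (tangent0 p) (tangent0 p).
      rewrite !scale1r addr0 => /eqP.
      by rewrite -subr_eq subrr eq_sym => /eqP.
    have := PZ p k u 0 tu (tangent0 p).
    by rewrite P00 !addr0.
  by rewrite /tIP PZu -scalerBr !scalerA mulrC.
have nt0 A B Z : vector_field A -> vector_field B -> vector_field Z ->
    nabla0 A B p = 0 ->
    metric_path g0 g1 t p (nablat A B p) (Z p) = t * g1 p (nabla1 A B p) (Z p).
  move=> vA vB vZ AB0; have [tZ _] := vZ.
  rewrite (metric_path_nabla g0_metric g1_metric t01 nabla0_LC nabla1_LC LCt p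
    vA vB vZ).
  by rewrite AB0 (ip0l ip0 (tZ p)) mulr0 add0r.
(* [neumann_series] applies to [v := nablat C D p]; the test vectors are values
   of global vector fields, as [nt0] requires, because [P] and [tIP P t] act on
   vector fields *)
have qterm A B C D : vector_field A -> vector_field B -> vector_field C ->
    vector_field D -> nabla0 A B p = 0 -> nabla0 C D p = 0 ->
    exists2 l, (\sum_(1 <= k < N) g1 p (P p (iter k.-1 (tIP P t p) (nabla1 A B p)))
                  (nabla1 C D p)) @[N --> \oo] --> l
      & metric_path g0 g1 t p (nablat A B p) (nablat C D p) = t ^+ 2 * l.
  move=> vA vB vC vD AB0 CD0.
  have [t1AB _] := vN1 _ _ vA vB; have [t1CD _] := vN1 _ _ vC vD.
  have vtCD := vNt _ _ vC vD; have [ttCD _] := vtCD.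
  have [l cl lE] := neumann_series ip0 ip1 (tP p) (P_def p) q0 q1 A_contr
    (t1AB p) (t1CD p) (ttCD p) (fun k => nt0 _ _ _ vC vD
      (vP _ (vector_field_iter_tIP t k P_endo (vN1 _ _ vA vB))) CD0).
  by exists l => //; rewrite (nt0 _ _ _ vA vB vtCD AB0) -lE expr2 mulrA.
have XX0 := nabla0_XX p Fp; have XY0 := nabla0_XY p Fp.
have YY0 := nabla0_YY p Fp.
have [la cla laE] := qterm _ _ _ _ X_field X_field Y_field Y_field XX0 YY0.
have [lb clb lbE] := qterm _ _ _ _ X_field Y_field X_field Y_field XY0 XY0.
have cS : partial_sum @ \oo --> la - lb.
  apply: cvg_trans (cvgB cla clb); apply: near_eq_cvg; near=> N.
  by rewrite /partial_sum /term sumrB.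
split; first by apply/cvg_ex; exists (la - lb).
rewrite (cvg_lim _ cS) //.
rewrite (metric_path_curvature g0_metric g1_metric t01 nabla0_LC nabla1_LC LCt
  p X_field Y_field).
have [ta _] := vN1 _ _ X_field X_field.
have [tb _] := vN1 _ _ X_field Y_field.
have [tc _] := vN1 _ _ Y_field Y_field.
have split_g1 u v := orthogonal_splitting (u := u) (v := v) ip1
  (torus_tangent_sub F_torus) (top_proj p Fp) (perp_proj p Fp).
have T0 := tangent0 p.
rewrite laE lbE XX0 XY0 YY0 (ip0l ip0 T0) subrr mulr0 addr0.
rewrite (split_g1 _ _ (ta p) (tc p)) (split_g1 _ _ (tb p) (tb p)) -/a -/b -/c.
ring.
Unshelve. all: by end_near. Qed.
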